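(* For every $0<\alpha<\infty$ there exist constants $C_\alpha,D_\alpha>0$ depending only on $\alpha$ such that the following holds. Let $(T,d)$ be a finite nonempty semi-metric space, let $\mathcal{X}$ be a normed linear space, and let $(X_t)_{t\in T}$ be an $\mathcal{X}$-valued process which is $\psi_\alpha$ with respect to $d$. Then for any $t_0\in T$ and any $1\leq p<\infty$, $$\Big(\mathbb{E}\sup_{t\in T}\|X_t-X_{t_0}\|^p\Big)^{1/p}\leq C_\alpha\,\gamma_{\alpha,p}(T,d)+2\sup_{t\in T}\big(\mathbb{E}\|X_t-X_{t_0}\|^p\big)^{1/p}.$$ As a consequence, for any $t_0\in T$ and any $u\geq 1$, $$\mathbb{P}\Big(\sup_{t\in T}\|X_t-X_{t_0}\|> e^{1/\alpha}\big(C_\alpha\gamma_\alpha(T,d)+uD_\alpha\Delta_d(T)\big)\Big)\leq \exp(-u^\alpha/\alpha).$$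
   Context: A semi-metric $d$ on $T$ is a function $d:T\times T\to[0,\infty)$ with $d(x,x)=0$, $d(x,y)=d(y,x)$ and $d(x,z)\leq d(x,y)+d(y,z)$ (distinct points may have distance $0$). The diameter is $\Delta_d(T)=\sup_{s,t\in T}d(s,t)$. An $\mathcal{X}$-valued process $(X_t)_{t\in T}$ (a family of $\mathcal{X}$-valued random variables on a probability space, with all norms $\|X_t-X_s\|$ measurable) is called $\psi_\alpha$ with respect to $d$ if for all $s,t\in T$ and all $u\geq 0$, $\mathbb{P}(\|X_t-X_s\|>u\,d(t,s))\leq 2\exp(-u^\alpha)$. No independence of the increments is assumed. A sequence $\mathcal{T}=(T_n)_{n\geq 0}$ of nonempty subsets of $T$ is admissible if $|T_0|=1$ and $|T_n|\leq 2^{2^n}$ for all $n\geq 1$. Write $d(t,T_n)=\inf_{s\in T_n}d(t,s)$. The $\gamma_\alpha$-functional is $$\gamma_\alpha(T,d)=\inf_{\mathcal{T}}\sup_{t\in T}\sum_{n=0}^\infty 2^{n/\alpha}d(t,T_n),$$ and for $1\leq p<\infty$, with $l=\lfloor\log_2 p\rfloor$, its truncated version is $$\gamma_{\alpha,p}(T,d)=\inf_{\mathcal{T}}\sup_{t\in T}\sum_{n\geq l}2^{n/\alpha}d(t,T_n),$$ the infima being over all admissible sequences. *)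

(* Defs.v *)
From HB Require Import structures.
From mathcomp Require Import all_boot all_order all_algebra.
From mathcomp Require Import all_classical all_reals all_analysis.

Set Implicit Arguments.
Unset Strict Implicit.
Unset Printing Implicit Defensive.

Import Order.TTheory GRing.Theory Num.Theory.
Import numFieldNormedType.Exports.

Local Open Scope classical_set_scope.
Local Open Scope ring_scope.

Section SemiMetric.
Context {R : realType} {T : finType}.

Definition is_semimetric (d : T -> T -> R) : Prop :=
  [/\ forall x y, 0 <= d x y,
      forall x, d x x = 0,
      forall x y, d x y = d y x &
      forall x y z, d x z <= d x y + d y z].

Definition diameter (d : T -> T -> R) : R :=
  sup [set r | exists s t, r = d s t].

Definition dist_to (d : T -> T -> R) (t : T) (S : {set T}) : R :=
  inf [set d t s | s in [set` S]].

Definition admissible (Ts : nat -> {set T}) : Prop :=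
  [/\ forall n, Ts n != finset.set0,
      #|Ts 0%N| = 1%N &
      forall n, (1 <= n)%N -> (#|Ts n| <= 2 ^ (2 ^ n))%N].

Definition gamma_from (alpha : R) (l : nat) (d : T -> T -> R) : \bar R :=
  ereal_inf [set ereal_sup
    [set (\sum_(l <= n <oo) (2 `^ (n%:R / alpha) * dist_to d t (Ts n))%:E)%E
      | t in [set: T]]
    | Ts in admissible].

Definition gamma (alpha : R) (d : T -> T -> R) : \bar R :=
  gamma_from alpha 0 d.

(* For p >= 1 the logarithm is nonnegative, so [Num.truncn] is the floor. *)
Definition gamma_trunc (alpha p : R) (d : T -> T -> R) : \bar R :=
  gamma_from alpha (Num.truncn (ln p / ln 2)) d.

End SemiMetric.

Section Process.
Context {R : realType} {T : finType} {V : normedModType R}.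
Context {disp : measure_display} {Omega : measurableType disp}.

(* The increments are treated separately: in a nonseparable space the
   difference of two Borel maps need not be Borel. *)
Definition is_process (X : T -> Omega -> V) : Prop :=
  (forall t,
     measurable_fun [set: Omega] (X t : Omega -> g_sigma_algebraType (@open V)))
  /\ (forall s t, measurable_fun [set: Omega] (fun w => `|X t w - X s w|)).

Definition is_psi (P : probability Omega R) (alpha : R) (d : T -> T -> R)
    (X : T -> Omega -> V) : Prop :=
  forall (s t : T) (u : R), 0 <= u ->
    (P [set w | (u * d t s < `|X t w - X s w|)%R]
       <= (2 * expR (- (u `^ alpha)))%:E)%E.

Definition sup_increment (X : T -> Omega -> V) (t0 : T) (w : Omega) : R :=
  sup [set `|X t w - X t0 w| | t in [set: T]].

Definition moment_norm (P : probability Omega R) (p : R) (f : Omega -> R) :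
    \bar R :=
  ('E_P[fun w => (f w `^ p)%R] `^ p^-1)%E.

End Process.

(* Main.v *)
Require Import Defs.
From HB Require Import structures.
From mathcomp Require Import all_boot all_order all_algebra.
From mathcomp Require Import all_classical all_reals all_analysis.
From mathcomp Require Import measurable_realfun ring lra.

Set Implicit Arguments.
Unset Strict Implicit.
Unset Printing Implicit Defensive.

Import Order.TTheory GRing.Theory Num.Theory.
Import numFieldNormedType.Exports.

Local Open Scope classical_set_scope.
Local Open Scope ring_scope.

(** The increments W = |X_t - X_s| / d(t, s) satisfy E exp(W^alpha / 2) <= K0,
    hence E W^q <= (a q^(1/alpha))^q K0 for all q > 0. Chain along nearest points
    pi_n(t) of T_n from level l = floor(log2 p) on, with links
    Y = W / (8 a 2^(n/alpha)) at level n. Instead of tail bounds for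
    M = sup Y, one uses E Y^(2^n) <= K0 8^(-2^n): since p <= 2^n for n > l, the
    variable 1 + sum Y^(2^n) over all at most 4^(2^n) links of each level n > l
    dominates M^p, and its mean is at most 1 + K0. The starting points of the
    chains contribute a sum over T_l, and |T_l| <= 2^(2^l) <= 2^p produces the
    factor 2 after taking p-th roots. The tail bound is Markov's inequality for
    the moment of order p = u^alpha. *)

(** * Elementary bounds for powers, exponentials and the integer part of log2 *)

Section RealFacts.
Context {R : realType}.
Implicit Types (p q x : R) (n : nat).

(** This is [1 + y <= expR y] at [y = x / q], raised to the power [q] and rescaled. *)
Lemma powR_le_expR x q : 0 <= x -> 0 < q -> x `^ q <= q `^ q * expR x.
Proof.
move=> x0 q0.
have -> : x = q * (x / q) by rewrite mulrC divfK// gt_eqF.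
have xq0 : 0 <= x / q by rewrite divr_ge0// ltW.
rewrite powRM//; last exact: ltW.
rewrite ler_wpM2l ?powR_ge0// [q * _]mulrC expRM.
rewrite ge0_ler_powR ?nnegrE ?expR_ge0//; first exact: ltW.
by rewrite (le_trans _ (expR_ge1Dx _))// lerDr.
Qed.

Lemma powR_powRV x q : 0 <= x -> 0 < q -> (x `^ q) `^ q^-1 = x.
Proof. by move=> x0 q0; rewrite -powRrM divff ?gt_eqF// powRr1. Qed.

Lemma powRV_powR x q : 0 <= x -> 0 < q -> (x `^ q^-1) `^ q = x.
Proof. by move=> x0 q0; rewrite -powRrM mulVf ?gt_eqF// powRr1. Qed.

(** Since i + 1 <= 2^i, the terms are dominated by the geometric ones 2^-(i+1), whose partial sums
    are 1 - 2^-n. *)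
Lemma sum_half_expn m n :
  \sum_(m <= i < n) (2^-1 : R) ^+ (2 ^ i) <= 1.
Proof.
have [mn|nm] := leqP m n; last by rewrite big_geq// ltnW.
apply: (@le_trans _ _ (\sum_(0 <= i < n) (2^-1 : R) ^+ i.+1)).
  rewrite [leRHS](big_cat_nat (n := m))//= -[leLHS]add0r lerD//.
    by rewrite sumr_ge0// => i _; rewrite exprn_ge0// invr_ge0.
  apply: ler_sum => i _; rewrite ler_wiXn2l ?invr_ge0//; last exact: ltn_expl.
  by rewrite invf_le1// ler1n.
suff -> : \sum_(0 <= i < n) (2^-1 : R) ^+ i.+1 = 1 - 2^-1 ^+ n.
  by rewrite gerBl exprn_ge0// invr_ge0.
elim: n {mn} => [|n ih]; first by rewrite big_geq// expr0 subrr.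
rewrite big_nat_recr//= ih exprS; lra.
Qed.

(** With l the integer part of log2 p, this and the next lemma are the two halves of 2^l <= p <=
    2^(l+1). The first controls the size of T_l, the second lets exponents 2^n replace p at levels n
    > l. *)
Lemma truncn_log2_le p : 1 <= p -> (2 ^ Num.truncn (ln p / ln 2))%:R <= p.
Proof.
move=> p1; have p0 : 0 < p by rewrite (lt_le_trans ltr01).
have l2 : 0 < ln (2 : R) by rewrite ln_gt0// ltr1n.
have := @truncn_le R (ln p / ln 2).
rewrite divr_ge0 ?ln_ge0 ?ler1n// ler_pdivlMr//.
rewrite -ln_powR ler_ln ?posrE ?powR_gt0//.
by rewrite powR_mulrn// natrX.
Qed.

Lemma le_exp2_truncn_log2 p n : 1 <= p -> (Num.truncn (ln p / ln 2) < n)%N ->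
  p <= (2 ^ n)%:R.
Proof.
move=> p1 ln; have p0 : 0 < p by rewrite (lt_le_trans ltr01).
have l2 : 0 < exp.ln (2 : R) by rewrite ln_gt0// ltr1n.
have := @truncnS_gt R (exp.ln p / exp.ln 2).
rewrite ltr_pdivrMr// => /ltW h.
rewrite natrX -powR_mulrn// -ler_ln ?posrE ?powR_gt0// ln_powR (le_trans h)//.
by rewrite ler_pM2r// ler_nat.
Qed.

(* The value of the geometric series bounding [E exp (W ^ alpha / 2)]. *)
Definition exp_moment_bound : R := 1 + 2 * expR 2^-1 / (1 - expR (- 2^-1)).

Lemma exp_moment_bound_ge1 : 1 <= exp_moment_bound.
Proof.
by rewrite lerDl divr_ge0 ?mulr_ge0 ?expR_ge0// subr_ge0 expR_le1 oppr_le0 invr_ge0.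
Qed.

End RealFacts.
Arguments exp_moment_bound : clear implicits.

(** * Exponential and power moments of a variable with psi_alpha tails *)

Section Moments.
Context {R : realType} {disp : measure_display} {Omega : measurableType disp}.
Variable P : probability Omega R.
Implicit Types (alpha p q : R) (f g W : Omega -> R).

Definition psi_tail alpha W : Prop := forall u : R, 0 <= u ->
  (P [set w | (u < W w)%R] <= (2 * expR (- (u `^ alpha)))%:E)%E.

Lemma measurable_gt (f : Omega -> R) (c : R) : measurable_fun [set: Omega] f ->
  measurable [set w | c < f w].
Proof.
move=> mf; have := mf measurableT `]c, +oo[%classic (measurable_itv _).
rewrite setTI; congr measurable; apply/seteqP.
by split => w /=; rewrite in_itv/= andbT.
Qed.

Lemma measurable_powR_comp f q : measurable_fun [set: Omega] f ->
  measurable_fun [set: Omega] (fun w => f w `^ q).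
Proof. exact: (@measurableT_comp _ _ _ _ _ _ (@powR R ^~ q)). Qed.

(** If k < y <= k + 1, the k-th term alone dominates exp(y/2); the summand 1 takes care of y = 0. *)
Lemma expR_half_le_series (y : R) : 0 <= y ->
  ((expR (y / 2))%:E <= 1 + \sum_(0 <= k <oo)
     (expR (k.+1%:R / 2) * (k%:R < y)%R%:R)%:E)%E.
Proof.
move=> y0.
have t0 k : (0 <= (expR (k.+1%:R / 2) * (k%:R < y)%R%:R)%:E :> \bar R)%E.
  by rewrite lee_fin mulr_ge0// expR_ge0.
have [->|yn0] := eqVneq y 0.
  by rewrite mul0r expR0 leeDl// nneseries_ge0.
have {}y0 : 0 < y by rewrite lt0r yn0.
(* Truncation gives k <= y < k + 1, whereas the strict inequality is needed on the left; an integer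
   y therefore uses its predecessor. *)
have [k ky yk] : exists2 k, k%:R < y & y <= k.+1%:R.
  have := @truncn_le R y; have := @truncnS_gt R y.
  rewrite (ltW y0); case: (Num.truncn y) => [|k] y1.
    by exists 0%N => //; exact: ltW.
  rewrite le_eqVlt => /orP[/eqP yk|ky]; last by exists k.+1 => //; exact: ltW.
  by exists k; rewrite -yk// ltr_nat.
apply: (@le_trans _ _ (expR (k.+1%:R / 2) * (k%:R < y)%R%:R)%:E).
  by rewrite ky mulr1 lee_fin ler_expR ler_pM2r.
apply: (@le_trans _ _ (\sum_(0 <= k <oo) (expR (k.+1%:R / 2) * (k%:R < y)%R%:R)%:E)%E).
  apply: (le_trans _ (nneseries_lim_ge k.+1 _)) => //.
  by rewrite big_nat_recr//= leeDr// sume_ge0.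
by rewrite leeDr// lee01.
Qed.

(** Integrate the preceding series at y = W^alpha term by term. The tail at level k is at most 2
    exp(-k), so the terms are bounded by 2 e^(1/2) e^(-k/2), a geometric sequence. *)
Lemma exp_moment_le alpha W : 0 < alpha -> measurable_fun [set: Omega] W ->
    (forall w, 0 <= W w) -> psi_tail alpha W ->
  (\int[P]_w (expR (W w `^ alpha / 2))%:E <= (exp_moment_bound R)%:E)%E.
Proof.
move=> a0 mW W0 tW.
pose A (k : nat) := [set w | (k%:R < W w `^ alpha)%R].
have mWa : measurable_fun [set: Omega] (fun w => W w `^ alpha).
  exact: measurable_powR_comp.
have mA k : measurable (A k) by exact: measurable_gt.
pose F (k : nat) w : \bar R := ((expR (k.+1%:R / 2))%:E * (\1_(A k) w)%:E)%E.
have F0 k w : (0 <= F k w)%E by rewrite /F -EFinM lee_fin mulr_ge0// expR_ge0.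
have mF k : measurable_fun [set: Omega] (F k : Omega -> \bar R).
  by apply: measurable_funeM; apply/measurable_EFinP; exact: measurable_indic.
have mser : measurable_fun [set: Omega] (fun w => \sum_(0 <= k <oo) F k w)%E.
  by apply: (@ge0_emeasurable_sum _ _ _ setT F predT) => k *; [exact: F0|exact: mF].
apply: (@le_trans _ _ (\int[P]_w (1 + \sum_(0 <= k <oo) F k w))%E).
  apply: ge0_le_integral => //.
  - apply/measurable_EFinP; apply: (@measurableT_comp _ _ _ _ _ _ expR) => //.
    exact: measurable_funM.
  - exact: emeasurable_funD.
  - move=> w _; rewrite (le_trans (expR_half_le_series (powR_ge0 _ _)))//.
    rewrite leeD2l// lee_nneseries//.
    by move=> k *; rewrite /F indicE /A -EFinM lee_fin mem_setE.
rewrite ge0_integralD//; last by move=> w _; exact: nneseries_ge0.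
rewrite integral_cst// mul1e [X in (X + _ <= _)%E]probability_setT EFinD leeD2l//.
rewrite integral_nneseries//.
apply: lime_le; first by apply: is_cvg_nneseries => k _ _; exact: integral_ge0.
apply: nearW => n.
apply: (@le_trans _ _ (\sum_(0 <= k < n) (2 * expR 2^-1 * expR (- 2^-1) ^+ k)%:E)%E).
  apply: lee_sum => k _.
  rewrite /F ge0_integralZl_EFin ?expR_ge0//; last first.
  - by apply/measurable_EFinP; exact: measurable_indic.
  rewrite integral_indic// setIT.
  have PA : (P (A k) <= (2 * expR (- k%:R))%:E)%E.
    (* The tail hypothesis is used at u = k^(1/alpha), for which u^alpha = k. *)
    have -> : A k = [set w | (k%:R `^ alpha^-1 < W w)%R].
      apply/seteqP; split => w; rewrite /A/= => h.
        rewrite -(powR_powRV (W0 w) a0).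
        by rewrite gt0_ltr_powR ?nnegrE ?invr_gt0 ?ler0n ?powR_ge0.
      rewrite -(@powRV_powR _ k%:R _ _ a0)//.
      by rewrite gt0_ltr_powR ?nnegrE ?powR_ge0.
    by have := tW _ (powR_ge0 k%:R alpha^-1); rewrite powRV_powR.
  apply: (le_trans (lee_wpmul2l _ PA)); first by rewrite lee_fin expR_ge0.
  rewrite -EFinM lee_fin mulrCA -expRD -mulrA -expRM_natr -expRD.
  by rewrite ler_wpM2l// ler_expR -natr1; lra.
rewrite sumEFin lee_fin.
have := @geometric_le_lim R n (2 * expR 2^-1) (expR (- 2^-1)).
rewrite /series/= => -> //; rewrite ?expR_gt0 ?mulr_ge0 ?expR_ge0//.
by rewrite ger0_norm ?expR_ge0// expR_lt1 oppr_lt0 invr_gt0.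
Qed.

(** The value is chosen so that (a q^(1/alpha))^q = (2q/alpha)^(q/alpha), the constant produced by
    [powR_le_expR] at exponent q/alpha. *)
Definition moment_scale alpha : R := (2 / alpha) `^ alpha^-1.

Lemma moment_scale_gt0 alpha : 0 < alpha -> 0 < moment_scale alpha.
Proof. by move=> a0; rewrite powR_gt0// divr_gt0. Qed.

(** Put z = W^alpha / 2 and r = q / alpha. Then W^q = (2z)^r <= (2r)^r exp(z), and exp(z) has mean
    at most K0. *)
Lemma psi_moment_le alpha q W : 0 < alpha -> 0 < q ->
    measurable_fun [set: Omega] W -> (forall w, 0 <= W w) -> psi_tail alpha W ->
  (\int[P]_w (W w `^ q)%:E
     <= ((moment_scale alpha * q `^ alpha^-1) `^ q * exp_moment_bound R)%:E)%E.
Proof.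
move=> a0 q0 mW W0 tW.
have qa0 : 0 < q / alpha by rewrite divr_gt0.
have -> : (moment_scale alpha * q `^ alpha^-1) `^ q = (2 / alpha * q) `^ (q / alpha).
  rewrite /moment_scale -powRM ?divr_ge0 ?(ltW a0) ?(ltW q0)//.
  by rewrite -powRrM [X in _ `^ X]mulrC.
apply: (@le_trans _ _ (\int[P]_w (((2 / alpha * q) `^ (q / alpha))%:E *
    (expR (W w `^ alpha / 2))%:E))%E).
  apply: ge0_le_integral => //.
  - by move=> w _; rewrite lee_fin powR_ge0.
  - by apply/measurable_EFinP; exact: measurable_powR_comp.
  - apply: measurable_funeM; apply/measurable_EFinP.
    apply: (@measurableT_comp _ _ _ _ _ _ expR) => //.
    by apply: measurable_funM => //; exact: measurable_powR_comp.
  - move=> w _; rewrite -EFinM lee_fin.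
    have -> : W w `^ q = (2 * (W w `^ alpha / 2)) `^ (q / alpha).
      by rewrite mulrC divfK// -powRrM mulrC divfK// gt_eqF.
    have -> : 2 / alpha * q = 2 * (q / alpha) by rewrite mulrAC mulrA.
    rewrite [leLHS]powRM ?divr_ge0 ?powR_ge0// [X in X * expR _]powRM ?(ltW qa0)// -mulrA.
    by rewrite ler_wpM2l ?powR_ge0// powR_le_expR// divr_ge0 ?powR_ge0.
rewrite ge0_integralZl_EFin ?powR_ge0//; first last.
- apply/measurable_EFinP; apply: (@measurableT_comp _ _ _ _ _ _ expR) => //.
  by apply: measurable_funM => //; exact: measurable_powR_comp.
rewrite EFinM lee_wpmul2l ?lee_fin ?powR_ge0//.
exact: exp_moment_le.
Qed.

End Moments.

(** * The L^p norm of nonnegative variables *)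

Section MomentNorm.
Context {R : realType} {disp : measure_display} {Omega : measurableType disp}.
Variable P : probability Omega R.
Implicit Types (a c p : R) (f g : Omega -> R).

Lemma moment_norm_ge0 p f : (0 <= moment_norm P p f)%E.
Proof. exact: poweR_ge0. Qed.

Lemma expectation_powR_ge0 p f : (0 <= 'E_P[fun w => (f w `^ p)%R])%E.
Proof. by rewrite unlock integral_ge0// => w _; rewrite lee_fin powR_ge0. Qed.

Lemma moment_norm_Lnorm p f : (forall w, 0 <= f w) ->
  moment_norm P p f = ('N[P]_(p%:E) [EFin \o f])%E.
Proof.
move=> f0; rewrite /moment_norm !unlock; congr poweR.
by apply: eq_integral => w _; rewrite /= ger0_norm.
Qed.

Lemma poweR_moment_norm p f : 0 < p ->
  (moment_norm P p f `^ p = 'E_P[fun w => (f w `^ p)%R])%E.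
Proof.
move=> p0; rewrite /moment_norm -poweRrM ?mulVf ?gt_eqF// poweRe1//.
exact: expectation_powR_ge0.
Qed.

Lemma moment_normD p f g : 1 <= p ->
    measurable_fun [set: Omega] f -> measurable_fun [set: Omega] g ->
    (forall w, 0 <= f w) -> (forall w, 0 <= g w) ->
  (moment_norm P p (fun w => f w + g w)%R <= moment_norm P p f + moment_norm P p g)%E.
Proof.
move=> p1 mf mg f0 g0.
rewrite !moment_norm_Lnorm//; last by move=> w; rewrite addr_ge0.
exact: (@minkowski_EFin _ _ _ P f g p).
Qed.

(** Domination almost everywhere is the form required later: increments between points at distance 0
    vanish only almost surely. *)
Lemma moment_norm_le_ae p f g : 0 < p ->
    measurable_fun [set: Omega] f -> measurable_fun [set: Omega] g ->
    (forall w, 0 <= f w) -> (forall w, 0 <= g w) ->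
    {ae P, forall w, f w <= g w} ->
  (moment_norm P p f <= moment_norm P p g)%E.
Proof.
move=> p0 mf mg f0 g0 fg.
rewrite /moment_norm gt0_ler_poweR ?invr_ge0 ?(ltW p0)//;
  rewrite ?in_itv/= ?leey ?expectation_powR_ge0//.
rewrite !unlock; apply: ae_ge0_le_integral => //.
- by move=> w _; rewrite lee_fin powR_ge0.
- by apply/measurable_EFinP; exact: measurable_powR_comp.
- by move=> w _; rewrite lee_fin powR_ge0.
- by apply/measurable_EFinP; exact: measurable_powR_comp.
- apply: filterS fg => w fgw _; rewrite lee_fin.
  by rewrite ge0_ler_powR ?nnegrE ?(ltW p0).
Qed.

Lemma moment_normZ p a f : 0 < p -> 0 <= a ->
    measurable_fun [set: Omega] f -> (forall w, 0 <= f w) ->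
  moment_norm P p (fun w => a * f w) = (a%:E * moment_norm P p f)%E.
Proof.
move=> p0 a0 mf f0; rewrite /moment_norm !unlock.
under eq_integral do rewrite powRM// EFinM.
rewrite ge0_integralZl_EFin ?powR_ge0//; first last.
- by apply/measurable_EFinP; exact: measurable_powR_comp.
- by move=> w _; rewrite lee_fin powR_ge0.
rewrite poweRM ?lee_fin ?powR_ge0//; last first.
  by rewrite integral_ge0// => w _; rewrite lee_fin powR_ge0.
by rewrite poweR_EFin powR_powRV.
Qed.

(** Integrate the pointwise bound of c^p times the indicator of f > c by f^p. *)
Lemma moment_markov p c f : 0 < p -> 0 < c -> measurable_fun [set: Omega] f ->
    (forall w, 0 <= f w) ->
  ((c `^ p)%:E * P [set w | (c < f w)%R] <= moment_norm P p f `^ p)%E.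
Proof.
move=> p0 c0 mf f0; rewrite poweR_moment_norm// unlock.
have mc := measurable_gt c mf.
rewrite -[X in P X]setIT -integral_indic// -ge0_integralZl_EFin ?powR_ge0//; last first.
- by apply/measurable_EFinP; exact: measurable_indic.
apply: ge0_le_integral => //.
- by move=> w _; rewrite -EFinM lee_fin mulr_ge0// powR_ge0.
- by apply: measurable_funeM; apply/measurable_EFinP; exact: measurable_indic.
- by apply/measurable_EFinP; exact: measurable_powR_comp.
- move=> w _; rewrite -EFinM lee_fin indicE; have [cf|_] := boolP (w \in _).
    rewrite mulr1 ge0_ler_powR ?nnegrE ?(ltW p0) ?(ltW c0)//.
    by move: cf; rewrite inE => /ltW.
  by rewrite mulr0 powR_ge0.
Qed.

End MomentNorm.

(** * Suprema over a finite index set *)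

Section FiniteSup.
Context {R : realType} {T : finType}.

Lemma has_ubound_finite (F : T -> R) : has_ubound [set F t | t in [set: T]].
Proof.
exists (\big[Num.max/0]_t F t) => _ [t _ <-].
exact: le_bigmax.
Qed.

End FiniteSup.

Section SupIncrement.
Context {R : realType} {T : finType} {V : normedModType R}.
Context {disp : measure_display} {Omega : measurableType disp}.
Variables (X : T -> Omega -> V) (t0 : T).

Lemma le_sup_increment t w : `|X t w - X t0 w| <= sup_increment X t0 w.
Proof. by apply: ub_le_sup; [exact: has_ubound_finite|exists t]. Qed.

Lemma sup_increment_ge0 w : 0 <= sup_increment X t0 w.
Proof. exact: le_trans (le_sup_increment t0 w). Qed.

Lemma sup_increment_le c w : (forall t, `|X t w - X t0 w| <= c) ->
  sup_increment X t0 w <= c.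
Proof.
move=> Xc; apply: ge_sup => [|_ [t _ <-]//].
by exists `|X t0 w - X t0 w|, t0.
Qed.

Lemma measurable_sup_increment : is_process X ->
  measurable_fun [set: Omega] (sup_increment X t0).
Proof.
move=> [_ mX].
(* The supremum is a finite maximum, measurable by induction over the enumeration. The default 0 is
   harmless, as the increments are nonnegative. *)
have -> : sup_increment X t0 =
    (fun w => \big[Num.max/0]_(t <- enum T) `|X t w - X t0 w|).
  apply/funext => w; apply/eqP; rewrite eq_le big_enum/=; apply/andP; split.
    by apply: sup_increment_le => t; exact: le_bigmax.
  by apply/bigmax_leP; split=> [|t _]; [exact: sup_increment_ge0|exact: le_sup_increment].
elim: (enum T) => [|t s ih].
  by under eq_fun do rewrite big_nil; exact: measurable_cst.
by under eq_fun do rewrite big_cons; exact: measurable_maxr.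
Qed.

End SupIncrement.

(** * Deterministic chaining along nearest points *)

Section Chaining.
Context {R : realType} {T : finType}.
Variables (d : T -> T -> R) (alpha : R).
Hypotheses (sd : is_semimetric d) (alpha0 : 0 < alpha).
Implicit Types (Ts : nat -> {set T}) (S : {set T}) (t : T).

Local Notation weight n := (2 `^ (n%:R / alpha) : R).

Lemma dist_toP t S : S != finset.set0 ->
  exists2 s, s \in S & d t s = dist_to d t S.
Proof.
move=> /set0Pn[s0 s0S].
case: (arg_minP (d t) s0S) => s sS smin; exists s => //.
apply/eqP; rewrite eq_le; apply/andP; split.
  by apply: lb_le_inf => [|_ [s' s'S <-]]; [exists (d t s0), s0|exact: smin].
apply: ge_inf; last by exists s.
by exists (d t s) => _ [s' s'S <-]; exact: smin.
Qed.

Lemma dist_to_ge0 t S : S != finset.set0 -> 0 <= dist_to d t S.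
Proof. by case: sd => d0 _ _ _ /(dist_toP t)[s _ <-]. Qed.

Lemma nearest_pointP Ts : (forall n, Ts n != finset.set0) ->
  exists pi : nat -> T -> T, forall n t,
    pi n t \in Ts n /\ d t (pi n t) = dist_to d t (Ts n).
Proof.
move=> Ts0.
have /choice[pi pP] (nt : nat * T) :
    exists s, s \in Ts nt.1 /\ d nt.2 s = dist_to d nt.2 (Ts nt.1).
  by have [s] := dist_toP nt.2 (Ts0 nt.1); exists s.
by exists (fun n t => pi (n, t)) => n t; exact: (pP (n, t)).
Qed.

Lemma weight_ge1 n : 1 <= weight n.
Proof. by rewrite -[leLHS](powRr0 2) ler_powR ?ler1n// divr_ge0// ltW. Qed.

Lemma weightS n : weight n.+1 = 2 `^ alpha^-1 * weight n.
Proof.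
by rewrite -powRD ?pnatr_eq0 ?implybT// -(natr1 n) mulrDl mul1r addrC.
Qed.

(** Telescope from pi_l(t) to pi_N(t) and route each d(pi_(n+1)(t), pi_n(t)) through t. The distance
    to T_n then carries the weight of level n + 1, which costs the factor 2^(1/alpha). *)
Lemma chaining_le (V : normedModType R) (x : T -> V) (Q : R) Ts
    (pi : nat -> T -> T) (l N : nat) t :
    0 <= Q -> (l <= N)%N -> (forall n, Ts n != finset.set0) ->
    (forall n u, pi n u \in Ts n /\ d u (pi n u) = dist_to d u (Ts n)) ->
    (forall n s s', (l <= n < N)%N -> s \in Ts n.+1 -> s' \in Ts n ->
       `|x s - x s'| <= Q * weight n.+1 * d s s') ->
  `|x (pi N t) - x (pi l t)| <=
    Q * (1 + 2 `^ alpha^-1) * \sum_(l <= n < N.+1) weight n * dist_to d t (Ts n).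
Proof.
move=> Q0 lN Ts0 piP; pose e n := weight n * dist_to d t (Ts n).
have e0 n : 0 <= e n by rewrite mulr_ge0 ?powR_ge0// dist_to_ge0.
have s0 a b : 0 <= \sum_(a <= n < b) e n by apply: sumr_ge0 => n _; exact: e0.
have [_ _ dC dD] := sd.
move=> xQ.
(* The two sums are kept apart in the induction: the link from N to N + 1 adds [e N.+1] to the first
   and [e N] to the second. *)
suff : `|x (pi N t) - x (pi l t)| <= Q * (\sum_(l <= n < N.+1) e n +
    2 `^ alpha^-1 * \sum_(l <= n < N) e n).
  move=> /le_trans; apply; rewrite -mulrA ler_wpM2l// mulrDl mul1r lerD2l.
  by rewrite ler_wpM2l ?powR_ge0// big_nat_recr//= lerDl; exact: e0.
elim: N lN xQ => [|N ih].
  rewrite leqn0 => /eqP -> _.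
  by rewrite subrr normr0 mulr_ge0// addr_ge0 ?mulr_ge0 ?powR_ge0.
rewrite leq_eqVlt => /predU1P[-> _|].
  by rewrite subrr normr0 mulr_ge0// addr_ge0 ?mulr_ge0 ?powR_ge0.
rewrite ltnS => lN xQ.
have {}ih : `|x (pi N t) - x (pi l t)| <= Q * (\sum_(l <= n < N.+1) e n +
    2 `^ alpha^-1 * \sum_(l <= n < N) e n).
  apply: ih => // n s s' /andP[ln nN]; apply: xQ.
  by rewrite ln ltnW.
have step : `|x (pi N.+1 t) - x (pi N t)| <= Q * (e N.+1 + 2 `^ alpha^-1 * e N).
  have [pN dN] := piP N t; have [pN1 dN1] := piP N.+1 t.
  apply: (le_trans (xQ N _ _ _ pN1 pN)); first by rewrite lN ltnSn.
  rewrite -mulrA ler_wpM2l//.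
  rewrite [X in _ + X]mulrA -weightS -mulrDr ler_wpM2l ?powR_ge0//.
  by rewrite -dN -dN1 (le_trans (dD _ t _))// lerD2r dC.
rewrite -(subrKA (x (pi N t))) (le_trans (ler_normD _ _))//.
rewrite (le_trans (lerD step ih))// -mulrDr ler_wpM2l//.
rewrite [X in _ <= X + _]big_nat_recr/=; last by rewrite leqW.
rewrite [X in _ <= _ + _ * X]big_nat_recr//=.
lra.
Qed.

(* A finite weighted sum forces some [Ts N] to be at distance 0 from every
   point, because the nonzero distances in a finite space are bounded below. *)
Lemma exact_approximation Ts (l : nat) (S : R) :
    (forall n, Ts n != finset.set0) ->
    (forall t, (\sum_(l <= n <oo) (weight n * dist_to d t (Ts n))%:E <= S%:E)%E) ->
  exists2 N, (l <= N)%N & forall t, dist_to d t (Ts N) = 0.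
Proof.
move=> Ts0 sumS; have [d0 _ _ _] := sd.
(* The smallest positive distance, capped at 1 so that it is positive even when all distances
   vanish. *)
pose eps := \big[Num.min/1%R]_(st : T * T | 0 < d st.1 st.2) d st.1 st.2.
have eps0 : 0 < eps by rewrite /eps; elim/big_ind: _ => // x y x0 y0; rewrite lt_min x0.
have epsP n t : dist_to d t (Ts n) != 0 -> eps <= dist_to d t (Ts n).
  have [s _ <-] := dist_toP t (Ts0 n) => dn0.
  by apply: (@bigmin_le_cond _ _ _ _ (t, s)) => /=; rewrite lt0r dn0 d0.
have dist0 n t := dist_to_ge0 t (Ts0 n).
apply: contrapT => noN.
(* If no level is exact, every level has a point at distance at least [eps], and the weights are at
   least 1. *)
have far n : (l <= n)%N -> eps <= \sum_t weight n * dist_to d t (Ts n).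
  move=> ln; apply: contrapT => /negP; rewrite -ltNge => small; apply: noN.
  exists n => // t; apply/eqP; apply: contrapT => /negP /epsP nt.
  move: small; rewrite ltNge => /negP; apply.
  rewrite (bigD1 t)//= (le_trans nt)//.
  apply: (@le_trans _ _ (weight n * dist_to d t (Ts n))).
    by rewrite ler_peMl// weight_ge1.
  by rewrite lerDl sumr_ge0// => t' _; rewrite mulr_ge0// powR_ge0.
(* Adding m such levels and exchanging the sums gives m eps <= |T| S for every m, which is absurd
   for large m. *)
have bound m : eps *+ m <= S *+ #|T|.
  have -> : eps *+ m = \sum_(l <= n < l + m) eps.
    by rewrite big_const_nat addKn iter_addr_0.
  apply: (@le_trans _ _ (\sum_(l <= n < l + m) \sum_t weight n * dist_to d t (Ts n))).
    by rewrite ler_sum_nat// => n /andP[ln _]; exact: far.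
  rewrite exchange_big/= -sumr_const ler_sum// => t _.
  rewrite -lee_fin -sumEFin (le_trans _ (sumS t))//.
  apply: nneseries_lim_ge => n _ _.
  by rewrite lee_fin mulr_ge0// powR_ge0.
have := bound (Num.truncn (S *+ #|T| / eps)).+1.
rewrite leNgt => /negP; apply.
by rewrite -mulr_natr mulrC -ltr_pdivrMr// truncnS_gt.
Qed.

End Chaining.

(** * Finite families of almost sure events and finite sums of integrals *)

Lemma ae_forall_finite (R : realType) disp (Omega : measurableType disp)
    (P : probability Omega R) (I : finType) (A : I -> Omega -> Prop) :
  (forall i, {ae P, forall w, A i w}) -> {ae P, forall w, forall i, A i w}.
Proof.
move=> aeA.
suff : {ae P, forall w, forall i, i \in enum I -> A i w}.
  by apply: filterS => w wA i; apply: wA; rewrite mem_enum.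
elim: (enum I) => [|i s ih]; first exact: filterE.
apply: filterS2 (aeA i) ih => w Ai As j; rewrite inE => /predU1P[->//|].
exact: As.
Qed.

Lemma integral_sum_le (R : realType) disp (Omega : measurableType disp)
    (P : probability Omega R) (I : Type) (r : seq I) (D : pred I)
    (F : I -> Omega -> R) (b : I -> R) :
    (forall i, measurable_fun [set: Omega] (F i)) -> (forall i w, 0 <= F i w) ->
    (forall i, D i -> (\int[P]_w (F i w)%:E <= (b i)%:E)%E) ->
  (\int[P]_w (\sum_(i <- r | D i) F i w)%:E <= (\sum_(i <- r | D i) b i)%:E)%E.
Proof.
move=> mF F0 Fb; under eq_integral do rewrite -big_filter -sumEFin.
rewrite ge0_integral_sum//; last first.
- by move=> i w _; rewrite lee_fin.
- by move=> i; exact/measurable_EFinP.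
by rewrite big_filter -sumEFin lee_sum.
Qed.

(** * Increments of a psi_alpha process *)

Section PsiProcess.
Context {R : realType} {T : finType} {V : normedModType R}.
Context {disp : measure_display} {Omega : measurableType disp}.
Variables (P : probability Omega R) (alpha : R) (d : T -> T -> R).
Variable X : T -> Omega -> V.
Hypotheses (alpha0 : 0 < alpha) (sd : is_semimetric d).
Hypotheses (pX : is_process X) (psiX : is_psi P alpha d X).

Local Notation weight n := (2 `^ (n%:R / alpha) : R).
Local Notation K0 := (exp_moment_bound R).

Lemma measurable_increment s t :
  measurable_fun [set: Omega] (fun w => `|X t w - X s w|).
Proof. by case: pX. Qed.

(** When d(s,t) = 0 the event of a nonzero increment does not depend on u, so its probability is
    below 2 exp(-u^alpha) for all u and must be 0. *)
Lemma increment_eq0_ae : {ae P, forall w, forall st : T * T,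
  d st.1 st.2 = 0 -> `|X st.1 w - X st.2 w| = 0}.
Proof.
apply: ae_forall_finite => -[s t] /=.
have [dst|dst] := eqVneq (d s t) 0; last first.
  by apply: filterE => w /eqP; rewrite (negbTE dst).
pose A := [set w | 0 < `|X s w - X t w|].
have mA : measurable A by apply: measurable_gt; exact: measurable_increment.
exists A; split => //; last first.
  move=> w /= wA; rewrite /A/= lt0r normr_ge0 andbT.
  by apply/negP => /eqP XX; apply: wA => _.
apply/eqP; rewrite eq_le measure_ge0 andbT leNgt; apply/negP => PA0.
have PAfin : P A \is a fin_num by exact: fin_num_measure.
have tail (u : R) : 0 <= u -> (P A <= (2 * expR (- u))%:E)%E.
  move=> u0; have := psiX t s (powR_ge0 u alpha^-1).
  by rewrite dst; under eq_set do rewrite mulr0; rewrite powRV_powR.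
move: PA0 tail; rewrite -(fineK PAfin) lte_fin; set r := fine _ => r0 tail.
(* A probability r > 0 is refuted at u^alpha = 2/r, because exp(2/r) > 2/r. *)
have := tail (2 / r); rewrite divr_ge0 ?(ltW r0)// => /(_ isT).
rewrite lee_fin leNgt => /negP; apply.
rewrite expRN ltr_pdivrMr ?expR_gt0// mulrC -ltr_pdivrMr//.
by rewrite (lt_le_trans _ (expR_ge1Dx _))// ltrDr.
Qed.

(** Division by 0 yields 0, so pairs at distance 0 have ratio 0 and keep the tail bound. *)
Definition increment_ratio s t w := `|X t w - X s w| / d t s.

Lemma increment_ratio_ge0 s t w : 0 <= increment_ratio s t w.
Proof. by case: sd => d0 _ _ _; rewrite divr_ge0. Qed.

Lemma measurable_increment_ratio s t :
  measurable_fun [set: Omega] (increment_ratio s t).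
Proof. by apply: measurable_funM => //; exact: measurable_increment. Qed.

Lemma psi_tail_increment_ratio s t : psi_tail P alpha (increment_ratio s t).
Proof.
move=> u u0; have [d0 _ _ _] := sd.
apply: le_trans (psiX s t u0); apply: le_measure; rewrite ?inE.
- by apply: measurable_gt; exact: measurable_increment_ratio.
- by apply: measurable_gt; exact: measurable_increment.
move=> w /=; rewrite /increment_ratio.
have [->|dn0] := eqVneq (d t s) 0; first by rewrite invr0 mulr0 ltNge u0.
by rewrite ltr_pdivlMr// lt0r dn0 d0.
Qed.

Lemma increment_ratio_moment s t q : 0 < q ->
  (\int[P]_w (increment_ratio s t w `^ q)%:E
     <= ((moment_scale alpha * q `^ alpha^-1) `^ q * K0)%:E)%E.
Proof.
move=> q0; apply: psi_moment_le => //.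
- exact: measurable_increment_ratio.
- exact: increment_ratio_ge0.
- exact: psi_tail_increment_ratio.
Qed.

(** This converts individual moments into the diameter term of the tail bound. The root K0^(1/p) is
    replaced by K0, which is at least 1. *)
Lemma increment_moment_norm_le s t p : 1 <= p ->
  (moment_norm P p (fun w => `|X t w - X s w|)%R
     <= (moment_scale alpha * p `^ alpha^-1 * K0 * d t s)%:E)%E.
Proof.
move=> p1; have p0 : 0 < p by rewrite (lt_le_trans ltr01).
have [d0 _ _ _] := sd.
have K1 := @exp_moment_bound_ge1 R.
have K00 : 0 <= K0 by rewrite (le_trans ler01).
have a0 : 0 <= moment_scale alpha * p `^ alpha^-1 by rewrite mulr_ge0 ?powR_ge0.
have mW := measurable_increment_ratio s t.
apply: (@le_trans _ _ (moment_norm P p (fun w => d t s * increment_ratio s t w))).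
  apply: moment_norm_le_ae => //.
  - exact: measurable_increment.
  - exact: measurable_funM.
  - by move=> w; rewrite mulr_ge0// increment_ratio_ge0.
  apply: filterS increment_eq0_ae => w /(_ (t, s))/= X0.
  rewrite /increment_ratio; have [dts|dn0] := eqVneq (d t s) 0.
    by rewrite X0// mul0r mulr0.
  by rewrite mulrC divfK.
rewrite moment_normZ//; last exact: increment_ratio_ge0.
rewrite [leRHS]EFinM muleC lee_wpmul2r ?lee_fin//.
apply: (@le_trans _ _ (((moment_scale alpha * p `^ alpha^-1) `^ p * K0)%:E `^ p^-1)%E).
  rewrite /moment_norm gt0_ler_poweR ?invr_ge0 ?(ltW p0)//.
  - by rewrite in_itv/= leey expectation_powR_ge0.
  - by rewrite in_itv/= leey lee_fin mulr_ge0 ?powR_ge0.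
  - by rewrite unlock increment_ratio_moment.
rewrite poweR_EFin lee_fin powRM ?powR_ge0// powR_powRV//.
by rewrite ler_wpM2l// ler1_powR// invf_le1.
Qed.

(** * Chaining for one admissible sequence at a fixed exponent p *)

Section Admissible.
Variables (Ts : nat -> {set T}) (p : R).
Hypotheses (aTs : admissible Ts) (p1 : 1 <= p).

Let l := Num.truncn (ln p / ln 2).
Let p0 : 0 < p. Proof. exact: lt_le_trans ltr01 p1. Qed.
(** The 8 yields link moments of order 8^(-q) with q = 2^n; the at most 4^q links of that level
    leave the summable 2^(-q). *)
Let K := 8 * moment_scale alpha.

Let K_gt0 : 0 < K. Proof. by rewrite mulr_gt0// moment_scale_gt0. Qed.

Let weight_gt0 n : 0 < weight n. Proof. by rewrite powR_gt0. Qed.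

Let link n s s' w := increment_ratio s' s w / (K * weight n).

Let link_ge0 n s s' w : 0 <= link n s s' w.
Proof. by rewrite divr_ge0 ?increment_ratio_ge0// mulr_ge0// ltW. Qed.

Let measurable_link n s s' : measurable_fun [set: Omega] (link n s s').
Proof. by apply: measurable_funM => //; exact: measurable_increment_ratio. Qed.

(** The index [n] is the coarser level of the link; weight and exponent belong to level n + 1. For q
    = 2^(n+1), q^(1/alpha) is exactly [weight n.+1], so the two cancel in the q-th moment. *)
Let link_pow n s s' w := link n.+1 s s' w `^ (2 ^ n.+1)%:R.

Let measurable_link_pow n s s' : measurable_fun [set: Omega] (link_pow n s s').
Proof. exact: measurable_powR_comp. Qed.

Let level_sum n w := \sum_(s in Ts n.+1) \sum_(s' in Ts n) link_pow n s s' w.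

(* [p]-th powers of links are bounded by [2 ^ n]-th powers, whose moments decay
   fast enough to absorb the [4 ^ (2 ^ n)] links of level [n]. *)
Let chain_max N w := 1 + \sum_(l <= n < N) level_sum n w.

Lemma card_admissible n : (#|Ts n| <= 2 ^ (2 ^ n))%N.
Proof. by case: aTs => _ T0 Tn; case: n => [|n]; [rewrite T0|exact: Tn]. Qed.

Let link_pow_moment n s s' :
  (\int[P]_w (link_pow n s s' w)%:E <= (K0 * 8^-1 ^+ (2 ^ n.+1))%:E)%E.
Proof.
set q : R := (2 ^ n.+1)%:R.
have q0 : 0 < q by rewrite ltr0n expn_gt0.
have a0 := moment_scale_gt0 alpha0.
have c0 : 0 <= (K * weight n.+1)^-1 by rewrite invr_ge0 mulr_ge0// ltW.
rewrite /link_pow /link; under eq_integral.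
  move=> w _; rewrite mulrC powRM ?increment_ratio_ge0// EFinM; over.
rewrite ge0_integralZl_EFin ?powR_ge0//; first last.
- apply/measurable_EFinP/measurable_powR_comp; exact: measurable_increment_ratio.
- by move=> w _; rewrite lee_fin powR_ge0.
apply: (le_trans (lee_wpmul2l _ (increment_ratio_moment s' s q0))).
  by rewrite lee_fin powR_ge0.
rewrite -EFinM lee_fin mulrA -powRM ?mulr_ge0 ?powR_ge0// mulrC.
have -> : q `^ alpha^-1 = weight n.+1.
  by rewrite /q natrX -powR_mulrn// -powRrM.
have -> : (K * weight n.+1)^-1 * (moment_scale alpha * weight n.+1) = 8^-1.
  rewrite /K; field.
  by rewrite !gt_eqF.
by rewrite powR_mulrn// invr_ge0.
Qed.

Let measurable_level_sum n : measurable_fun [set: Omega] (level_sum n).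
Proof.
rewrite /level_sum; under eq_fun do under eq_bigr do rewrite -big_enum.
under eq_fun do rewrite -big_enum.
by apply: measurable_sum => s; apply: measurable_sum => s'.
Qed.

Let measurable_chain_max N : measurable_fun [set: Omega] (chain_max N).
Proof. by apply: measurable_funD => //; exact: measurable_sum. Qed.

Let level_sum_ge0 n w : 0 <= level_sum n w.
Proof. by apply: sumr_ge0 => s _; apply: sumr_ge0 => s' _; exact: powR_ge0. Qed.

Let chain_max_ge1 N w : 1 <= chain_max N w.
Proof. by rewrite lerDl sumr_ge0. Qed.

Let level_sum_moment n :
  (\int[P]_w (level_sum n w)%:E <= (K0 * 2^-1 ^+ (2 ^ n.+1))%:E)%E.
Proof.
have K1 := @exp_moment_bound_ge1 R.
have K00 : 0 <= K0 by rewrite (le_trans ler01).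
pose b := K0 * 8^-1 ^+ (2 ^ n.+1).
apply: (@le_trans _ _ (\sum_(s in Ts n.+1) \sum_(s' in Ts n) b)%:E).
  apply: integral_sum_le => [s|s w|s _].
  - under eq_fun do rewrite -big_enum.
    exact: measurable_sum.
  - by apply: sumr_ge0 => s' _; exact: powR_ge0.
  - apply: integral_sum_le => // s' w; exact: powR_ge0.
rewrite lee_fin !sumr_const -mulrnA -[leLHS]mulr_natr /b -mulrA ler_wpM2l//.
(* The number of pairs is at most 2^q 2^q = 4^q with q = 2^(n+1). *)
have -> : (2^-1 : R) = 8^-1 * 4 by field.
rewrite exprMn ler_wpM2l ?exprn_ge0 ?invr_ge0//.
rewrite -natrX ler_nat (_ : 4 = 2 * 2)%N// expnMn leq_mul//.
  rewrite (leq_trans (card_admissible _))// leq_exp2l// leq_exp2l//.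
exact: card_admissible.
Qed.

Let chain_max_expectation N : (\int[P]_w (chain_max N w)%:E <= (1 + K0)%:E)%E.
Proof.
have K1 := @exp_moment_bound_ge1 R.
have K00 : 0 <= K0 by rewrite (le_trans ler01).
under eq_integral do rewrite /chain_max EFinD.
rewrite ge0_integralD//; first last.
- by apply/measurable_EFinP; exact: measurable_sum.
- by move=> w _; rewrite lee_fin sumr_ge0.
rewrite integral_cst// mul1e [X in (X + _ <= _)%E]probability_setT EFinD leeD2l//.
apply: (@le_trans _ _ (\sum_(l <= n < N) (K0 * 2^-1 ^+ (2 ^ n.+1)))%:E).
  exact: integral_sum_le.
rewrite lee_fin -[leRHS]mulr1 -mulr_sumr ler_wpM2l//.
(* The exponents 2^(n+1) shift the range to l + 1, ..., N. *)
by apply: le_trans (sum_half_expn l.+1 N.+1); rewrite big_add1.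
Qed.

(** A link at most 1 is covered by the summand 1 of [chain_max]. For a larger link, p <= 2^(n+1)
    bounds its p-th power by its [link_pow], one of the other summands. *)
Let increment_le_chain_max N n s s' w :
    (forall st : T * T, d st.1 st.2 = 0 -> `|X st.1 w - X st.2 w| = 0) ->
    (l <= n < N)%N -> s \in Ts n.+1 -> s' \in Ts n ->
  `|X s w - X s' w| <= K * chain_max N w `^ p^-1 * weight n.+1 * d s s'.
Proof.
move=> X0 /andP[ln nN] sT s'T; have [d0 _ _ _] := sd.
have [dss|dss] := eqVneq (d s s') 0; first by rewrite dss mulr0 (X0 (s, s')).
have -> : `|X s w - X s' w| = K * link n.+1 s s' w * weight n.+1 * d s s'.
  rewrite /link /increment_ratio; field.
  by rewrite dss !gt_eqF.
rewrite ler_wpM2r// ler_wpM2r ?(ltW (weight_gt0 _))// ler_wpM2l ?(ltW K_gt0)//.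
rewrite -(powR_powRV (link_ge0 n.+1 s s' w) p0).
rewrite ge0_ler_powR ?invr_ge0 ?(ltW p0) ?nnegrE ?powR_ge0//.
  by rewrite (le_trans ler01).
have [le1|gt1] := lerP (link n.+1 s s' w) 1.
  rewrite (le_trans _ (chain_max_ge1 _ _))// -[leRHS](congr1 (@^~ p) (@powR1 R)).
  by rewrite ge0_ler_powR ?(ltW p0) ?nnegrE.
apply: (@le_trans _ _ (link_pow n s s' w)).
  by rewrite ler_powR ?(ltW gt1)// le_exp2_truncn_log2.
rewrite /chain_max (big_cat_nat (n := n))//=; last exact: ltnW.
rewrite (big_ltn (m := n))//= /level_sum (bigD1 s)//= (bigD1 s')//=.
rewrite -!addrA addrCA [leRHS]addrCA -[leLHS]addr0 lerD2l.
have lp0 i r r' : 0 <= link_pow i r r' w by exact: powR_ge0.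
rewrite !addr_ge0// sumr_ge0// => i _.
- exact: level_sum_ge0.
- exact: sumr_ge0.
- exact: level_sum_ge0.
Qed.

(** An l^p sum replaces the maximum over T_l, so that its p-th moment is a sum of individual p-th
    moments. *)
Let base_max t0 w := (\sum_(s in Ts l) `|X s w - X t0 w| `^ p) `^ p^-1.

Let measurable_base_max t0 : measurable_fun [set: Omega] (base_max t0).
Proof.
apply: measurable_powR_comp; under eq_fun do rewrite -big_enum.
apply: measurable_sum => s; apply: measurable_powR_comp.
exact: measurable_increment.
Qed.

Let base_max_moment t0 :
  (moment_norm P p (base_max t0) <= 2%:E * ereal_sup
     [set moment_norm P p (fun w => `|X t w - X t0 w|)%R | t in [set: T]])%E.
Proof.
set M := ereal_sup _.
have MX s : (moment_norm P p (fun w => `|X s w - X t0 w|)%R <= M)%E.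
  by apply: ereal_sup_ubound; exists s.
have M0 : (0 <= M)%E by rewrite (le_trans _ (MX t0))// moment_norm_ge0.
have M2 : (0 <= 2%:E * M)%E by rewrite mule_ge0.
have -> : (2%:E * M = ((2%:E * M) `^ p) `^ p^-1)%E.
  by rewrite -poweRrM mulfV ?lt0r_neq0// poweRe1.
rewrite /moment_norm gt0_ler_poweR ?invr_ge0 ?(ltW p0)//.
- by rewrite in_itv/= leey expectation_powR_ge0.
- by rewrite in_itv/= leey poweR_ge0.
rewrite unlock; under eq_integral.
  move=> w _; rewrite powRV_powR//; last by apply: sumr_ge0 => s _; exact: powR_ge0.
  over.
have [->|My] := eqVneq M +oo%E.
  by rewrite gt0_muley// poweRyr ?leey// gt_eqF.
have Mfin : M \is a fin_num by rewrite ge0_fin_numE// ltey.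
move: M0 MX; rewrite -(fineK Mfin) lee_fin; set m := fine M => m0 MX.
apply: (@le_trans _ _ (\sum_(s in Ts l) m `^ p)%:E).
  apply: integral_sum_le => [s|s w|s _]; last 2 first.
  - exact: powR_ge0.
  - have := MX s; move/(gt0_ler_poweR (ltW p0)).
    rewrite poweR_moment_norm// unlock; apply.
      by rewrite in_itv/= leey moment_norm_ge0.
    by rewrite in_itv/= leey lee_fin m0.
  by apply: measurable_powR_comp; exact: measurable_increment.
rewrite -EFinM poweR_EFin lee_fin sumr_const -[leLHS]mulr_natl.
rewrite [leRHS]powRM// ler_wpM2r ?powR_ge0//.
(* The count |T_l| <= 2^(2^l) <= 2^p turns the sum into (2m)^p. *)
apply: (@le_trans _ _ (2 `^ (2 ^ l)%:R)).
  by rewrite powR_mulrn// -natrX ler_nat card_admissible.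
by rewrite ler_powR ?ler1n// truncn_log2_le.
Qed.

Lemma moment_sup_increment_le t0 :
  (moment_norm P p (sup_increment X t0) <=
     (K * (1 + 2 `^ alpha^-1) * (1 + K0))%:E *
       ereal_sup [set (\sum_(l <= n <oo) (weight n * dist_to d t (Ts n))%:E)%E
         | t in [set: T]]
     + 2%:E * ereal_sup
         [set moment_norm P p (fun w => `|X t w - X t0 w|)%R | t in [set: T]])%E.
Proof.
set S := ereal_sup _; set M := ereal_sup _.
have [Ts0 _ _] := aTs.
have K1 := @exp_moment_bound_ge1 R.
have K00 : 0 <= K0 by rewrite (le_trans ler01).
have SX t : (\sum_(l <= n <oo) (weight n * dist_to d t (Ts n))%:E <= S)%E.
  by apply: ereal_sup_ubound; exists t.
have C0 : 0 < K * (1 + 2 `^ alpha^-1) * (1 + K0).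
  by rewrite (mulr_gt0 (mulr_gt0 K_gt0 _))// ltr_pwDl.
have M0 : (0 <= M)%E.
  apply: le_trans (moment_norm_ge0 P p (fun w => `|X t0 w - X t0 w|)%R) _.
  by apply: ereal_sup_ubound; exists t0.
have S0 : (0 <= S)%E.
  apply: le_trans (SX t0); apply: nneseries_ge0 => n _ _.
  by rewrite lee_fin mulr_ge0 ?powR_ge0// dist_to_ge0.
have [Sy|] := eqVneq S +oo%E.
  rewrite Sy gt0_muley// addye ?leey//.
  by rewrite -ltNye (lt_le_trans _ (mule_ge0 _ M0)) ?ltNy0// lee_fin.
rewrite -ltey => Slty.
have Sfin : S \is a fin_num by rewrite ge0_fin_numE.
move: S0 SX; rewrite -(fineK Sfin) lee_fin; set S' := fine S => S0 SX.
(* Finiteness of S stops the chains at a common level N, where X_t and X at pi_N(t) agree almost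
   surely. *)
have [N lN exactN] := exact_approximation sd alpha0 Ts0 SX.
have [pi piP] := nearest_pointP d Ts0.
pose A := K * (1 + 2 `^ alpha^-1) * S'.
have A0 : 0 <= A by rewrite mulr_ge0 ?(mulr_ge0 (ltW K_gt0)) ?addr_ge0 ?powR_ge0.
pose Q w := chain_max N w `^ p^-1.
have mQ : measurable_fun [set: Omega] Q by exact: measurable_powR_comp.
have mAQ : measurable_fun [set: Omega] (fun w => A * Q w) by exact: measurable_funM.
have AQ0 w : 0 <= A * Q w by rewrite mulr_ge0// powR_ge0.
apply: (@le_trans _ _ (moment_norm P p (fun w => A * Q w + base_max t0 w)%R)).
  apply: moment_norm_le_ae => //.
  - exact: measurable_sup_increment.
  - exact: measurable_funD.
  - exact: sup_increment_ge0.
  - by move=> w; rewrite addr_ge0// powR_ge0.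
  apply: filterS increment_eq0_ae => w X0; apply: sup_increment_le => t.
  have -> : X t w = X (pi N t) w.
    apply/eqP; rewrite -subr_eq0 -normr_eq0; apply/eqP/(X0 (t, pi N t)) => /=.
    by have [_ ->] := piP N t; exact: exactN.
  (* Split at pi_l(t): the links above it are bounded by [A * Q], the starting point by
     [base_max]. *)
  rewrite -(subrKA (X (pi l t) w)) (le_trans (ler_normD _ _))// lerD//.
    have KQ0 : 0 <= K * Q w by rewrite mulr_ge0 ?(ltW K_gt0) ?powR_ge0.
    apply: (le_trans (@chaining_le _ _ d alpha sd V (X^~ w) _ Ts pi l N t
      KQ0 lN Ts0 piP _)).
      move=> n s s' lnN sT s'T; exact: increment_le_chain_max lnN sT s'T.
    have -> : A * Q w = K * Q w * (1 + 2 `^ alpha^-1) * S' by rewrite /A; ring.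
    rewrite ler_wpM2l ?(mulr_ge0 KQ0) ?addr_ge0 ?powR_ge0//.
    rewrite -lee_fin -sumEFin (le_trans _ (SX t))//.
    apply: nneseries_lim_ge => n _ _.
    by rewrite lee_fin mulr_ge0 ?powR_ge0// dist_to_ge0.
  have [pl _] := piP l t.
  rewrite -(powR_powRV (normr_ge0 (X (pi l t) w - X t0 w)) p0).
  rewrite ge0_ler_powR ?invr_ge0 ?(ltW p0) ?nnegrE ?powR_ge0//.
    by apply: sumr_ge0 => s _; exact: powR_ge0.
  rewrite (bigD1 (pi l t))//= lerDl sumr_ge0// => s _; exact: powR_ge0.
have base0 w : 0 <= base_max t0 w by exact: powR_ge0.
apply: (le_trans (moment_normD P p1 mAQ (measurable_base_max t0) AQ0 base0)).
apply: leeD; last exact: base_max_moment.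
rewrite moment_normZ//; last by move=> w; exact: powR_ge0.
rewrite -EFinM (_ : _ * S' = A * (1 + K0)); last by rewrite /A; ring.
rewrite [leRHS]EFinM lee_wpmul2l ?lee_fin//.
(* The p-th power of [Q] is [chain_max], of mean at most 1 + K0; since this is at least 1, taking
   the p-th root does not increase it. *)
apply: (@le_trans _ _ ((1 + K0)%:E `^ p^-1)%E).
  rewrite /moment_norm gt0_ler_poweR ?invr_ge0 ?(ltW p0)//.
  - by rewrite in_itv/= leey expectation_powR_ge0.
  - by rewrite in_itv/= leey lee_fin addr_ge0.
  rewrite unlock; under eq_integral.
    move=> w _; rewrite powRV_powR//; last by rewrite (le_trans ler01).
    over.
  exact: chain_max_expectation.
by rewrite poweR_EFin lee_fin ler1_powR ?lerDl ?invf_le1.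
Qed.

End Admissible.
End PsiProcess.

(** For finite y, subtract y and divide by c. For y = +oo, nonnegativity of the infimum excludes the
    form -oo + oo. *)
Lemma le_affine_ereal_inf (R : realType) (c : R) (y z : \bar R) (A : set (\bar R)) :
    0 < c -> (0 <= y)%E -> (0 <= ereal_inf A)%E ->
    (forall x, A x -> (z <= c%:E * x + y)%E) ->
  (z <= c%:E * ereal_inf A + y)%E.
Proof.
move=> c0 y0 A0 zA; have [->|yy] := eqVneq y +oo%E.
  by rewrite addey ?leey// -ltNye (lt_le_trans _ (mule_ge0 _ A0)) ?ltNy0// lee_fin ltW.
have yfin : y \is a fin_num by rewrite ge0_fin_numE// ltey.
rewrite -leeBlDr// -lee_pdivrMl//; apply: le_ereal_inf_tmp => x Ax.
by rewrite lee_pdivrMl// leeBlDr// zA.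
Qed.

(** * Comparison of the gamma functionals, and the diameter *)

Section Gamma.
Context {R : realType} {T : finType}.
Variables (d : T -> T -> R) (alpha : R).
Hypothesis sd : is_semimetric d.

Let term_ge0 (Ts : nat -> {set T}) (t : T) (n : nat) : admissible Ts ->
  (0 <= (2 `^ (n%:R / alpha) * dist_to d t (Ts n))%:E :> \bar R)%E.
Proof. by case=> Ts0 _ _; rewrite lee_fin mulr_ge0 ?powR_ge0// dist_to_ge0. Qed.

Lemma gamma_from_ge0 l (t : T) : (0 <= gamma_from alpha l d)%E.
Proof.
apply: le_ereal_inf_tmp => _ [Ts aTs <-].
apply: (@le_trans _ _ (\sum_(l <= n <oo)
    (2 `^ (n%:R / alpha) * dist_to d t (Ts n))%:E)%E).
  by apply: nneseries_ge0 => n _ _; exact: term_ge0.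
by apply: ereal_sup_ubound; exists t.
Qed.

Lemma gamma_from_le l : (gamma_from alpha l d <= gamma alpha d)%E.
Proof.
apply: le_ereal_inf_tmp => _ [Ts aTs <-].
apply: le_trans (ereal_inf_lbound _) _; first by exists Ts.
apply: ge_ereal_sup => _ [t _ <-].
apply: (@le_trans _ _ (\sum_(0 <= n <oo)
    (2 `^ (n%:R / alpha) * dist_to d t (Ts n))%:E)%E).
  rewrite [leRHS](@nneseries_split _ _ 0 l) ?add0n ?leeDr// => *; last exact: term_ge0.
  by apply: sume_ge0 => n _; exact: term_ge0.
by apply: ereal_sup_ubound; exists t.
Qed.

Lemma le_diameter s t : d s t <= diameter d.
Proof.
apply: ub_le_sup; last by exists s, t.
have [M Mub] := has_ubound_finite (fun st : T * T => d st.1 st.2).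
by exists M => _ [s' [t' ->]]; apply: Mub; exists (s', t').
Qed.

End Gamma.

(** * Choice of constants, and the tail bound from the moment bound *)

Theorem theorem3p2 (R : realType) (alpha : R) (halpha : 0 < alpha) :
  exists C D : R, 0 < C /\ 0 < D /\
    forall (T : finType) (d : T -> T -> R) (V : normedModType R)
      (disp : measure_display) (Omega : measurableType disp)
      (P : probability Omega R) (X : T -> Omega -> V),
      is_semimetric d -> is_process X -> is_psi P alpha d X ->
      forall t0 : T,
        (forall p : R, 1 <= p ->
          (moment_norm P p (sup_increment X t0)
             <= C%:E * gamma_trunc alpha p d
                + 2%:E * ereal_sup
                    [set moment_norm P p (fun w => `|X t w - X t0 w|)%R
                      | t in [set: T]])%E) /\
        (forall u : R, 1 <= u ->
          (P [set w |
                ((expR alpha^-1)%:E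
                   * (C%:E * gamma alpha d + (u * D * diameter d)%:E)
                 < (sup_increment X t0 w)%:E)%E]
             <= (expR (- (u `^ alpha / alpha)))%:E)%E).
Proof.
have K1 := @exp_moment_bound_ge1 R.
have K0 : 0 < exp_moment_bound R by rewrite (lt_le_trans ltr01).
have a0 := moment_scale_gt0 halpha.
pose C := 8 * moment_scale alpha * (1 + 2 `^ alpha^-1) * (1 + exp_moment_bound R).
(* The 2 is the factor before the individual moments, and the rest is the constant of
   [increment_moment_norm_le]. *)
pose D := 2 * (moment_scale alpha * exp_moment_bound R).
have C0 : 0 < C.
  by rewrite (mulr_gt0 (mulr_gt0 (mulr_gt0 _ a0) _))// addr_gt0// powR_gt0.
have D0 : 0 < D by rewrite mulr_gt0// (mulr_gt0 a0).
exists C, D; split=> //; split=> // T d V disp Omega P X sd pX psiX t0.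
have moment_bound p : 1 <= p -> (moment_norm P p (sup_increment X t0)
     <= C%:E * gamma_trunc alpha p d + 2%:E * ereal_sup
          [set moment_norm P p (fun w => `|X t w - X t0 w|)%R | t in [set: T]])%E.
  move=> p1; apply: le_affine_ereal_inf => //.
  - rewrite mule_ge0//.
    apply: le_trans (moment_norm_ge0 P p (fun w => `|X t0 w - X t0 w|)%R) _.
    by apply: ereal_sup_ubound; exists t0.
  - exact: gamma_from_ge0.
  - by move=> _ [Ts aTs <-]; exact: moment_sup_increment_le.
split=> // u u1.
have u0 : 0 <= u by rewrite (le_trans ler01).
have mS := measurable_sup_increment t0 pX.
have S0 := sup_increment_ge0 X t0.
have [gy|] := eqVneq (gamma alpha d) +oo%E.
  rewrite gy gt0_muley ?lte_fin// addye// gt0_muley ?lte_fin ?expR_gt0//.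
  rewrite (_ : [set w | _] = set0) ?measure0 ?lee_fin ?expR_ge0//.
  by apply/seteqP; split.
rewrite -ltey => glty.
have gfin : gamma alpha d \is a fin_num by rewrite ge0_fin_numE// gamma_from_ge0.
have := gamma_from_ge0 alpha sd 0 t0.
rewrite -/(gamma alpha d) -(fineK gfin) lee_fin; set g := fine _ => g0.
pose b := C * g + u * D * diameter d.
have [d0 _ _ _] := sd.
have diam0 : 0 <= diameter d by rewrite (le_trans (d0 t0 t0))// le_diameter.
have Cg0 : 0 <= C * g by rewrite mulr_ge0// ltW.
have uDd0 : 0 <= u * D * diameter d by rewrite !mulr_ge0// ltW.
have b0 : 0 <= b by rewrite addr_ge0.
pose c := expR alpha^-1 * b.
rewrite (_ : [set w | _] = [set w | c < sup_increment X t0 w]); last first.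
  by apply/eq_set => w; rewrite -(lte_fin c) (EFinM _ b) EFinD (EFinM C).
(* Markov's inequality needs a positive threshold. If b = 0, then u D > 0 forces the diameter to
   vanish, and all increments are almost surely 0. *)
have [bE|bn0] := eqVneq b 0.
  have diamE : diameter d = 0.
    move/eqP: bE; rewrite paddr_eq0// => /andP[_].
    by rewrite mulf_eq0 gt_eqF ?(mulr_gt0 _ D0) ?(lt_le_trans ltr01)//= => /eqP.
  rewrite measure_negligible ?lee_fin ?expR_ge0//; first exact: measurable_gt.
  rewrite /c bE mulr0.
  have [N [mN PN0 subN]] := increment_eq0_ae halpha pX psiX.
  exists N; split=> // w Sw; apply: subN => /= X0.
  move: Sw; apply/negP; rewrite -leNgt.
  apply: sup_increment_le => t; rewrite (X0 (t, t0))//=.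
  by apply/eqP; rewrite eq_le d0 andbT -diamE le_diameter.
have {}b0 : 0 < b by rewrite lt0r bn0.
have c0 : 0 < c by rewrite mulr_gt0// expR_gt0.
(* Then p^(1/alpha) = u, and u >= 1 ensures p >= 1. *)
pose p := u `^ alpha.
have p1 : 1 <= p by rewrite /p -[leLHS](powRr0 u) ler_powR// ltW.
have p0 : 0 < p by rewrite (lt_le_trans ltr01).
have normS : (moment_norm P p (sup_increment X t0) <= b%:E)%E.
  apply: le_trans (moment_bound p p1) _.
  rewrite /b [leRHS]EFinD leeD//.
    by rewrite [leRHS]EFinM (fineK gfin) lee_pmul2l// gamma_from_le.
  rewrite (_ : u * D * _ =
    2 * (moment_scale alpha * u * exp_moment_bound R * diameter d)); last first.
    by rewrite /D; ring.
  rewrite [leRHS]EFinM lee_pmul2l//; apply: ge_ereal_sup => _ [t _ <-].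
  apply: le_trans (increment_moment_norm_le halpha sd pX psiX t0 t p1) _.
  rewrite powR_powRV// lee_fin ler_wpM2l ?le_diameter//.
  by rewrite (mulr_ge0 (mulr_ge0 (ltW a0) u0))// ltW.
have := moment_markov P p0 c0 mS S0.
have cp0 : 0 < c `^ p by rewrite powR_gt0.
rewrite -lee_pdivlMl// => /le_trans; apply; rewrite lee_pdivrMl//.
(* With c = e^(1/alpha) b, the quotient (b/c)^p equals exp(-p/alpha), the claimed bound. *)
apply: (@le_trans _ _ (b%:E `^ p)%E).
  rewrite gt0_ler_poweR ?(ltW p0)//.
  - by rewrite in_itv/= leey moment_norm_ge0.
  - by rewrite in_itv/= leey lee_fin ltW.
rewrite poweR_EFin -EFinM lee_fin /c powRM ?expR_ge0 ?(ltW b0)//.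
by rewrite -expRM mulrAC -expRD [p / _]mulrC subrr expR0 mul1r.
Qed.
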